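(* Let $R$ be a maximal subring of a ring $T$. Assume that $T$ has a nonzero ideal $I$ such that $R\cap I=0$. Then the following are equivalent: (1) $R$ is a left primitive ring, $l.ann_T(I)=0$ and $I$ has a maximal left $T$-submodule. (2) $T$ is a left primitive ring and $I$ is a left primitive ideal of $T$. Moreover, if any of these equivalent conditions holds, then $(R:T)=(R:T)_l=(R:T)_r=0$.
   Context: All rings are associative and unital (not necessarily commutative), and subrings contain the identity of the big ring; ''ideal'' means two-sided ideal. A maximal subring $R$ of $T$ is a proper subring with no subring strictly between $R$ and $T$. Conductors: $(R:T)=\{x\in T: TxT\subseteq R\}$, $(R:T)_l=\{x\in T: Tx\subseteq R\}$, $(R:T)_r=\{x\in T: xT\subseteq R\}$. $l.ann_T(I)=\{t\in T: tI=0\}$. *)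

(* Defs.v *)
From HB Require Import structures.
From mathcomp Require Import all_boot all_algebra.
From mathcomp Require Import boolp classical_sets.

Set Implicit Arguments.
Unset Strict Implicit.
Unset Printing Implicit Defensive.

Import GRing.Theory.
Local Open Scope classical_set_scope.
Local Open Scope ring_scope.

(* Rings are [pzRingType]s: unital, not necessarily commutative (the zero ring
   is allowed).  Subrings, ideals and submodules are arbitrary sets (Prop-valued
   predicates), seen as boolean predicates through classical logic whenever a
   closure property of the library is used. *)

Record subring (T : pzRingType) := Subring {
  subring_set :> set T;
  subring_setP : subring_closed [in subring_set]
}.

Definition subring_type (T : pzRingType) (R : subring T) : Type :=
  {x : T | x \in subring_set R}.

HB.instance Definition _ (T : pzRingType) (R : subring T) :=
  SubChoice.on (subring_type R).
HB.instance Definition _ (T : pzRingType) (R : subring T) :=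
  GRing.SubChoice_isSubPzRing.Build T _ (subring_type R) (subring_setP R).

Definition maximal_subring (T : pzRingType) (R : subring T) : Prop :=
  subring_set R <> setT /\
  forall S : subring T, R `<=` S -> subring_set S = R \/ subring_set S = setT.

Definition ideal (T : pzRingType) (I : set T) : Prop :=
  zmod_closed [in I] /\ forall t x : T, I x -> I (t * x) /\ I (x * t).

Definition conductor (T : pzRingType) (R : set T) : set T :=
  [set x | forall s t : T, R (s * x * t)].

Definition left_conductor (T : pzRingType) (R : set T) : set T :=
  [set x | forall t : T, R (t * x)].

Definition right_conductor (T : pzRingType) (R : set T) : set T :=
  [set x | forall t : T, R (x * t)].

Definition left_annihilator (T : pzRingType) (I : set T) : set T :=
  [set t | forall x : T, I x -> t * x = 0].

Definition submodule (A : pzRingType) (M : lmodType A) (N : set M) : Prop :=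
  submod_closed [in N].

Definition simple_module (A : pzRingType) (M : lmodType A) : Prop :=
  [set: M] <> [set 0] /\
  forall N : set M, submodule N -> N = [set 0] \/ N = setT.

Definition module_annihilator (A : pzRingType) (M : lmodType A) : set A :=
  [set a | forall m : M, a *: m = 0].

Definition left_primitive_ideal (A : pzRingType) (P : set A) : Prop :=
  exists M : lmodType A, simple_module M /\ P = module_annihilator M.

Definition left_primitive_ring (A : pzRingType) : Prop :=
  exists M : lmodType A, simple_module M /\ module_annihilator M = [set 0].

Definition maximal_submodule (A : pzRingType) (M : lmodType A) (L N : set M) :
    Prop :=
  [/\ submodule N, N `<=` L, N <> L &
    forall K : set M, submodule K -> N `<=` K -> K `<=` L -> K = N \/ K = L].

(* Main.v *)
Require Import Defs.
From HB Require Import structures.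
From mathcomp Require Import all_boot all_algebra.
From mathcomp Require Import boolp classical_sets.

Set Implicit Arguments.
Unset Strict Implicit.
Unset Printing Implicit Defensive.

Import GRing.Theory.
Local Open Scope classical_set_scope.
Local Open Scope ring_scope.

(** Since [R] is maximal and meets [I] trivially, [T = R + I], so [T / I] is
    isomorphic to [R] and [I] is a left primitive ideal iff [R] is a left
    primitive ring (restriction of scalars along [T -> R], resp. [R -> T]).
    For the same reason [I] contains no two-sided ideal of [T] other than [0]
    and [I].

    If [M] is a faithful simple [T]-module and [m <> 0], then [I m = M]; this
    gives the vanishing of both annihilators of [I], and
    [{x in I | x m = 0}] is a maximal submodule of [I].  Conversely, let [N]
    be a maximal submodule of [I] and let [P] be the annihilator of [I / N].  If
    [P `&` I <> 0] then [I] is contained in [P], so [I I] is contained in [N],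
    hence in the largest two-sided ideal inside [N], which is [0]; this
    contradicts [l.ann(I) = 0].  So [P I = 0], that is [P = 0], and [I / N] is
    faithful.  Both one-sided conductors multiply [I] into [R `&` I = 0]. *)

(** * Restriction of scalars along a ring morphism *)

Section RestrictScalars.
Variables (A B : pzRingType) (f : {rmorphism A -> B}) (M : lmodType B).

(** An alias of [M] tagged with [f]: the addition is inherited from [M], and the action of [A]
    depends on [f]. *)
Definition restrict_scalars of {rmorphism A -> B} : Type := M.
Local Notation fM := (restrict_scalars f).

HB.instance Definition _ := GRing.Zmodule.on fM.

Definition restrict_scale (a : A) (m : fM) : fM := f a *: (m : M).

Fact restrict_scaleA a b m :
  restrict_scale a (restrict_scale b m) = restrict_scale (a * b) m.
Proof. by rewrite /restrict_scale rmorphM scalerA. Qed.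

Fact restrict_scale1 : left_id 1 restrict_scale.
Proof. by move=> m; rewrite /restrict_scale rmorph1 scale1r. Qed.

Fact restrict_scaleDr : right_distributive restrict_scale +%R.
Proof. by move=> a m n; rewrite /restrict_scale scalerDr. Qed.

Fact restrict_scaleDl m : {morph restrict_scale^~ m : a b / a + b}.
Proof. by move=> a b; rewrite /restrict_scale rmorphD scalerDl. Qed.

Definition restrict_lmod : lmodType A :=
  HB.pack fM (GRing.Zmodule_isLmodule.Build A fM
    restrict_scaleA restrict_scale1 restrict_scaleDr restrict_scaleDl).

Lemma restrict_scaleE (a : A) (m : restrict_lmod) : a *: m = f a *: (m : M).
Proof. by []. Qed.

End RestrictScalars.

(** * Submodules and simple modules *)

Section Submodules.
Variables (A : pzRingType) (M : lmodType A).
Implicit Types N : set M.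

Lemma submoduleP N :
  submodule N <-> N 0 /\ forall a u v, N u -> N v -> N (a *: u + v).
Proof.
split=> [[] | [N0 NL]]; first rewrite inE => N0 NL.
  by split=> // a u v Nu Nv; have := NL a u v; rewrite !inE; apply.
by split=> [|a u v]; rewrite !inE //; exact: NL.
Qed.

Lemma submodule0 N : submodule N -> N 0.
Proof. by case/submoduleP. Qed.

Lemma submoduleD N u v : submodule N -> N u -> N v -> N (u + v).
Proof. by case/submoduleP=> _ NL Nu Nv; rewrite -[u]scale1r; apply: NL. Qed.

Lemma submoduleZ N a u : submodule N -> N u -> N (a *: u).
Proof. by case/submoduleP=> N0 NL Nu; rewrite -[_ *: _]addr0; apply: NL. Qed.

Lemma submoduleB N u v : submodule N -> N u -> N v -> N (u - v).
Proof.
move=> sN Nu Nv; rewrite -scaleN1r; apply: submoduleD => //.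
exact: submoduleZ.
Qed.

Lemma submodule_cyclic (m : M) :
  submodule ([set a *: m | a in [set: A]] : set M).
Proof.
apply/submoduleP; split=> [|a _ _ [b _ <-] [c _ <-]].
  by exists 0; rewrite ?scale0r.
by exists (a * b + c); rewrite // scalerDl scalerA.
Qed.

Section SimpleModule.
Hypothesis simpleM : simple_module M.

Lemma simple_neq0 : exists m : M, m <> 0.
Proof.
apply: contrapT => /forallNP M0; case: simpleM => + _; apply.
by apply/seteqP; split=> // m _; apply: contrapT => /M0.
Qed.

Lemma simple_submodule_full N m : submodule N -> N m -> m <> 0 -> N = setT.
Proof.
move=> sN Nm m0; case: (simpleM.2 N sN) => // N0.
by move: Nm; rewrite N0.
Qed.

End SimpleModule.

(** Together with [simple_cyclic], this turns simplicity into a condition on elements, which is easy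
    to carry through changes of ring and quotients. *)
Lemma simple_of_cyclic :
  (exists m : M, m <> 0) ->
  (forall m m' : M, m <> 0 -> exists a, a *: m = m') -> simple_module M.
Proof.
move=> [m0 m0_neq0] cycM; split=> [MT|N sN].
  by have : [set: M] m0 by []; rewrite MT.
have [[m [Nm m_neq0]]|N0] := pselect (exists m, N m /\ m <> 0).
  right; apply/seteqP; split=> // m' _.
  by have [a <-] := cycM m m' m_neq0; exact: submoduleZ.
left; apply/seteqP; split=> [m Nm|_ ->]; last exact: submodule0.
by apply: contrapT => m_neq0; apply: N0; exists m.
Qed.

Lemma simple_cyclic : simple_module M ->
  forall m m' : M, m <> 0 -> exists a, a *: m = m'.
Proof.
move=> simM m m' m_neq0.
have Am_full : [set a *: m | a in [set: A]] = [set: M].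
  apply: (simple_submodule_full simM (submodule_cyclic m) _ m_neq0).
  by exists 1; rewrite ?scale1r.
have [a _ <-] : [set a *: m | a in [set: A]] m' by rewrite Am_full.
by exists a.
Qed.

End Submodules.

(** The hypothesis asks for surjectivity of [f] only on the operators of [M], so that it also covers
    the inclusion of [R] in [T]. *)
Lemma simple_restrict (A B : pzRingType) (f : {rmorphism A -> B})
    (M : lmodType B) :
    (forall b, exists a, forall m : M, f a *: m = b *: m) ->
  simple_module M -> simple_module (restrict_lmod f M).
Proof.
move=> fsurj simM; apply: simple_of_cyclic; first exact: (simple_neq0 simM).
move=> m m' /(simple_cyclic simM (m' : M))[b <-].
by have [a fa] := fsurj b; exists a; rewrite restrict_scaleE.
Qed.


(** * Quotient of a module by a submodule *)

Section QuotientModule.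
Variables (A : pzRingType) (M : lmodType A) (N : set M) (sN : submodule N).

Definition submodule_zmod_closed : zmodClosed M :=
  HB.pack [in N] (GRing.isZmodClosed.Build M [in N] (GRing.submod_closedB sN)).

Local Notation Q := (Quotient.quot submodule_zmod_closed).
Local Notation pi := (\pi_Q%qT : M -> Q).

Lemma quot_eqP (x y : M) : pi x = pi y <-> N (x - y).
Proof.
rewrite -[N _]in_setE.
by split=> [/eqP|?]; [|apply/eqP]; rewrite -Quotient.idealrBE.
Qed.

(** Scaling acts on a chosen representative; [quot_scale_pi] shows that the choice does not
    matter. *)
Definition quot_scale (a : A) (q : Q) : Q := pi (a *: repr q).

Lemma quot_scale_pi a x : quot_scale a (pi x) = pi (a *: x).
Proof.
apply/quot_eqP; rewrite -scalerBr; apply: submoduleZ => //.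
by apply/quot_eqP; rewrite reprK.
Qed.

Fact quot_scaleA a b q : quot_scale a (quot_scale b q) = quot_scale (a * b) q.
Proof.
by rewrite -[q]reprK [quot_scale b _]quot_scale_pi !quot_scale_pi scalerA.
Qed.

Fact quot_scale1 : left_id 1 quot_scale.
Proof. by move=> q; rewrite -[q]reprK quot_scale_pi scale1r. Qed.

Fact quot_scaleDr : right_distributive quot_scale +%R.
Proof.
move=> a q r; rewrite -[q]reprK -[r]reprK -raddfD !quot_scale_pi.
by rewrite scalerDr raddfD.
Qed.

Fact quot_scaleDl q : {morph quot_scale^~ q : a b / a + b}.
Proof. by move=> a b; rewrite -[q]reprK !quot_scale_pi scalerDl raddfD. Qed.

Definition quot_lmod : lmodType A :=
  HB.pack Q (GRing.Zmodule_isLmodule.Build A Q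
    quot_scaleA quot_scale1 quot_scaleDr quot_scaleDl).

Definition quot_proj : M -> quot_lmod := pi.

Lemma quot_proj_eq x y : quot_proj x = quot_proj y <-> N (x - y).
Proof. exact: quot_eqP. Qed.

Lemma quot_projZ a x : a *: quot_proj x = quot_proj (a *: x).
Proof. exact: quot_scale_pi. Qed.

Lemma quot_proj_surj q : exists x, quot_proj x = q.
Proof. by exists (repr (q : Q)); apply: reprK. Qed.

Lemma quot_proj_eq0 x : quot_proj x = 0 <-> N x.
Proof. by rewrite -(raddf0 pi) quot_proj_eq subr0. Qed.

End QuotientModule.

(** * Two-sided ideals *)

Section Ideals.
Variables (T : pzRingType) (J : set T) (idealJ : ideal J).

Lemma idealP : J 0 /\ forall x y, J x -> J y -> J (x - y).
Proof.
case: idealJ => -[]; rewrite inE => J0 JB _.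
by split=> // x y Jx Jy; have := JB x y; rewrite !inE; apply.
Qed.

Lemma ideal0 : J 0. Proof. exact: idealP.1. Qed.

Lemma idealB x y : J x -> J y -> J (x - y). Proof. exact: idealP.2. Qed.

Lemma idealN x : J x -> J (- x).
Proof. by rewrite -sub0r; apply: idealB; exact: ideal0. Qed.

Lemma idealD x y : J x -> J y -> J (x + y).
Proof. by move=> Jx Jy; rewrite -[y]opprK; apply/idealB/idealN. Qed.

Lemma idealMl t x : J x -> J (t * x). Proof. by move/(idealJ.2 t)=> []. Qed.

Lemma idealMr t x : J x -> J (x * t). Proof. by move/(idealJ.2 t)=> []. Qed.

Lemma ideal_submodule : submodule (J : set T^o).
Proof.
apply/submoduleP; split=> [|a u v Ju Jv]; first exact: ideal0.
by apply: idealD => //; apply: idealMl.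
Qed.

End Ideals.

Lemma ideal_setI (T : pzRingType) (I J : set T) :
  ideal I -> ideal J -> ideal (I `&` J).
Proof.
move=> idI idJ; split.
  split=> [|x y]; rewrite !inE; first by split; exact: ideal0.
  by move=> [Ix Jx] [Iy Jy]; split; apply: idealB.
by move=> t x [Ix Jx]; split; split; do [exact: idealMl | exact: idealMr].
Qed.

(** * Subrings and their sum with an ideal *)

Section SubringFacts.
Variables (T : pzRingType) (S : subring T).
Local Notation R := (subring_set S).

Lemma subringP : [/\ R 1, forall x y, R x -> R y -> R (x - y)
  & forall x y, R x -> R y -> R (x * y)].
Proof.
case: (subring_setP S); rewrite inE => R1 RB RM.
split=> // x y Rx Ry; first by have := RB x y; rewrite !inE; apply.
by have := RM x y; rewrite !inE; apply.
Qed.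

Lemma subring1 : R 1. Proof. by case: subringP. Qed.

Lemma subringB x y : R x -> R y -> R (x - y).
Proof. by case: subringP => _ + _; apply. Qed.

Lemma subringM x y : R x -> R y -> R (x * y).
Proof. by case: subringP => _ _; apply. Qed.

Lemma subring0 : R 0.
Proof. by rewrite -(subrr 1); apply: subringB; exact: subring1. Qed.

Lemma subring_add_ideal_closed (J : set T) : ideal J ->
  subring_closed [in [set t | exists2 r, R r & J (t - r)]].
Proof.
move=> idJ; split=> [|x y|x y]; rewrite !inE.
- by exists 1; rewrite ?subrr; [exact: subring1 | exact: ideal0].
- move=> [r Rr Jx] [s Rs Jy]; exists (r - s); first exact: subringB.
  by rewrite opprD addrACA -opprD; apply: idealB.
- move=> [r Rr Jx] [s Rs Jy]; exists (r * s); first exact: subringM.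
  have -> : x * y - r * s = (x - r) * y + r * (y - s).
    by rewrite mulrBl mulrBr addrA subrK.
  by apply: idealD => //; [exact: idealMr | exact: idealMl].
Qed.

(** The subring [R + J] contains [R], and differs from it because it contains [J]; maximality leaves
    only [T]. *)
Lemma maximal_subring_add_ideal (J : set T) (t : T) :
    maximal_subring S -> ideal J -> ~ J `<=` R ->
  exists2 r, R r & J (t - r).
Proof.
move=> [_ maxR] idJ JnR.
pose RJ := Subring (subring_add_ideal_closed idJ).
have [x Rx|RJR|RJT] := maxR RJ.
- by exists x; rewrite ?subrr //; exact: ideal0.
- case: JnR => x Jx; rewrite -RJR.
  by exists 0; rewrite ?subr0 //; exact: subring0.
- by have : subring_set RJ t by rewrite RJT.
Qed.

End SubringFacts.

(** * Nonzero ideals acting on a faithful simple module *)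

Section PrimitiveRing.
Variables (T : pzRingType) (M : lmodType T) (I : set T).
Hypotheses (simM : simple_module M) (faithM : module_annihilator M = [set 0]).
Hypotheses (idI : ideal I) (I_neq0 : I <> [set 0]).

Lemma faithful_eq0 (x : T) : (forall m : M, x *: m = 0) -> x = 0.
Proof. by move=> xM0; have : module_annihilator M x by []; rewrite faithM. Qed.

Lemma ideal_cyclic (m : M) :
  submodule ([set x *: m | x in I] : set M).
Proof.
apply/submoduleP; split=> [|a _ _ [x Ix <-] [y Iy <-]].
  by exists 0; rewrite ?scale0r //; exact: ideal0.
exists (a * x + y); last by rewrite scalerDl scalerA.
by apply: idealD => //; apply: idealMl.
Qed.

(** If [m] were nonzero, then [M = T m], so [I M = (I T) m] would vanish and faithfulness would give
    [I = 0]. *)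
Lemma ideal_scale_eq0 (m : M) : (forall x, I x -> x *: m = 0) -> m = 0.
Proof.
move=> Im0; apply: contrapT => m_neq0; apply: I_neq0; apply/seteqP.
split=> [x Ix|_ ->]; last exact: ideal0.
apply: faithful_eq0 => m'.
have [a <-] := simple_cyclic simM m' m_neq0.
by rewrite scalerA Im0 //; apply: idealMr.
Qed.

Lemma ideal_scale_full (m m' : M) : m <> 0 -> exists2 x, I x & x *: m = m'.
Proof.
move=> m_neq0; have [[x [Ix xm]]|Im0] := pselect (exists x, I x /\ x *: m <> 0).
  have Im_full : [set x *: m | x in I] = [set: M].
    by apply: (simple_submodule_full simM (ideal_cyclic m) _ xm); exists x.
  by have : [set x *: m | x in I] m' by rewrite Im_full.
case: m_neq0; apply: ideal_scale_eq0 => x Ix.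
by apply: contrapT => xm; apply: Im0; exists x.
Qed.

Lemma primitive_left_annihilator : left_annihilator I = [set 0].
Proof.
apply/seteqP; split=> [t tI0|_ -> x _]; last by rewrite mul0r.
apply: faithful_eq0 => m; have [m0 m0_neq0] := simple_neq0 simM.
by have [x Ix <-] := ideal_scale_full m m0_neq0; rewrite scalerA tI0 ?scale0r.
Qed.

Lemma primitive_right_annihilator t : (forall x, I x -> x * t = 0) -> t = 0.
Proof.
move=> It0; apply: faithful_eq0 => m; apply: ideal_scale_eq0 => x Ix.
by rewrite scalerA It0 // scale0r.
Qed.

(** The witness is the kernel of [x -> x m] on [I], whose image [I m = M] is simple. *)
Lemma primitive_maximal_submodule :
  exists N : set T^o, maximal_submodule (I : set T^o) N.
Proof.
have [m m_neq0] := simple_neq0 simM.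
exists [set x | I x /\ x *: m = 0]; split.
- apply/submoduleP; split=> [|a x y [Ix xm] [Iy ym]].
    by split; [exact: ideal0 | exact: scale0r].
  split; first by apply: idealD => //; apply: idealMl.
  by rewrite scalerDl -scalerA xm ym scaler0 addr0.
- by move=> x [].
- have [x Ix xm] := ideal_scale_full m m_neq0.
  move=> NI; case: m_neq0; rewrite -xm.
  by move: Ix; rewrite -NI => -[].
- move=> K sK NK KI.
  have [[k [Kk km]]|KN] := pselect (exists k : T, K k /\ k *: m <> 0);
    last first.
    left; apply/seteqP; split=> // x Kx; split; first exact: KI.
    by apply: contrapT => xm; apply: KN; exists x.
  right; apply/seteqP; split=> // x Ix.
  (* Since [k m] generates [M], some [a k] acts on [m] as [x] does; then [x - a k] lies in the
     kernel and [a k] in [K]. *)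
  have [a /esym akm] := simple_cyclic simM ((x : T) *: m) km.
  rewrite -[x](subrK (a *: (k : T^o))); apply: submoduleD => //.
    apply: NK; split.
      by apply: idealB => //; apply: idealMl => //; apply: KI.
    by rewrite scalerBl akm scalerA subrr.
  exact: submoduleZ.
Qed.

End PrimitiveRing.

(** * A maximal subring meeting a nonzero ideal trivially *)

Section MaximalSubring.
Variables (T : pzRingType) (S : subring T) (I : set T).
Local Notation R := (subring_set S).
Hypotheses (maxS : maximal_subring S) (idI : ideal I) (I_neq0 : I <> [set 0]).
Hypothesis RI0 : R `&` I = [set 0].

Lemma subring_ideal_eq0 x : R x -> I x -> x = 0.
Proof. by move=> Rx Ix; have : (R `&` I) x by []; rewrite RI0. Qed.

Lemma subideal_not_sub (J : set T) x : J `<=` I -> J x -> x <> 0 -> ~ J `<=` R.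
Proof.
move=> JI Jx x0 JR; apply: x0.
by apply: subring_ideal_eq0; [exact: JR | exact: JI].
Qed.

(** A nonzero [J] gives [T = R + J]; the [R]-component of an element of [I] is then in [I] too,
    hence zero. *)
Lemma subideal_eq (J : set T) x : ideal J -> J `<=` I -> J x -> x <> 0 -> J = I.
Proof.
move=> idJ JI Jx x0; apply/seteqP; split=> // i Ii.
have JnR := subideal_not_sub JI Jx x0.
have [r Rr Jir] := maximal_subring_add_ideal i maxS idJ JnR.
have r0 : r = 0.
  apply: subring_ideal_eq0 => //.
  by rewrite -[r](subKr i); apply: idealB => //; apply: JI.
by move: Jir; rewrite r0 subr0.
Qed.

Lemma subring_ideal_projection :
  exists f : {rmorphism T -> subring_type S}, 
    (forall t, I (t - \val (f t))) /\ forall r, f (\val r) = r.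
Proof.
have [x [Ix x_neq0]] : exists x, I x /\ x <> 0.
  apply: contrapT => I0; apply: I_neq0; apply/seteqP.
  split=> [x Ix|_ ->]; last exact: ideal0.
  by apply: contrapT => x_neq0; apply: I0; exists x.
have InR : ~ I `<=` R by apply: subideal_not_sub x_neq0.
have /choice[f fP] : forall t, exists r : subring_type S, I (t - \val r).
  move=> t; have [r Rr Itr] := maximal_subring_add_ideal t maxS idI InR.
  have r_in : r \in R by rewrite inE.
  by exists (Sub r r_in); rewrite SubK.
(* Uniqueness of the [R]-component, from which every morphism law of [f] follows. *)
have f_eq t r : I (t - \val r) -> f t = r.
  move=> Itr; apply: val_inj; apply/eqP; rewrite -subr_eq0; apply/eqP.
  apply: subring_ideal_eq0.
    apply: subringB; [move: (valP (f t))|move: (valP r)]; rewrite inE //.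
  have -> : \val (f t) - \val r = (t - \val r) - (t - \val (f t)).
    by rewrite opprB [RHS]addrC subrKA.
  by apply: idealB.
have fB : zmod_morphism f.
  move=> t u; apply: f_eq; rewrite rmorphB /= opprD addrACA -opprD.
  exact: idealB.
have fM : monoid_morphism f.
  split=> [|t u]; apply: f_eq.
    by rewrite rmorph1 subrr; exact: ideal0.
  rewrite rmorphM.
  have -> : t * u - \val (f t) * \val (f u) =
      (t - \val (f t)) * u + \val (f t) * (u - \val (f u)).
    by rewrite mulrBl mulrBr addrA subrK.
  by apply: idealD => //; [apply: idealMr | apply: idealMl].
pose g : {rmorphism T -> subring_type S} :=
  HB.pack f (GRing.isZmodMorphism.Build T (subring_type S) f fB)
    (GRing.isMonoidMorphism.Build T (subring_type S) f fM).
exists g; split=> // r; apply: f_eq; rewrite subrr; exact: ideal0.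
Qed.

Lemma primitive_subring_primitive_ideal :
  left_primitive_ring (subring_type S) <-> left_primitive_ideal I.
Proof.
have [f [fP fval]] := subring_ideal_projection.
(* The kernel of the retraction [f] is [I]. *)
have f_eq0 t : I t <-> f t = 0.
  split=> [It|ft0]; last by have := fP t; rewrite ft0 rmorph0 subr0.
  apply: val_inj; rewrite rmorph0; apply: subring_ideal_eq0.
    by have := valP (f t); rewrite inE.
  by rewrite -[\val _](subKr t); apply: idealB.
split=> -[M [simM annM]].
  exists (restrict_lmod f M); split.
    by apply: simple_restrict simM => r; exists (\val r) => m; rewrite fval.
  apply/seteqP; split=> [t It m|t tM0].
    by rewrite restrict_scaleE (f_eq0 t).1 // scale0r.
  by apply/f_eq0; have : module_annihilator M (f t) by []; rewrite annM.
(* As [I] kills [M], the elements [t] and [f t] act alike, so [R] has the same operators on [M] as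
   [T]. *)
exists (restrict_lmod \val M); split.
  apply: simple_restrict simM => t; exists (f t) => m.
  apply/eqP; rewrite -subr_eq0 -scalerBl -opprB scaleNr oppr_eq0; apply/eqP.
  have : I (t - \val (f t)) by [].
  by rewrite annM; apply.
apply/seteqP; split=> [r rM0|_ -> m]; last by rewrite scale0r.
have : I (\val r) by rewrite annM.
by rewrite f_eq0 fval.
Qed.

Lemma primitive_of_maximal_submodule (N : set T^o) :
  left_annihilator I = [set 0] -> maximal_submodule (I : set T^o) N ->
  left_primitive_ring T.
Proof.
move=> annI [sN NI N_neqI maxN].
have N0 : N (0 : T) := submodule0 sN.
have ND (x y : T) : N x -> N y -> N (x + y) := submoduleD sN.
have NB (x y : T) : N x -> N y -> N (x - y) := submoduleB sN.
have NM (t x : T) : N x -> N (t * x) := submoduleZ t sN.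
have annI0 t : (forall x, I x -> t * x = 0) -> t = 0.
  by move=> tI0; have : left_annihilator I t by []; rewrite annI.
(* Such elements form an ideal of [T] inside [N]; a nonzero one would force this ideal to be [I],
   against [N <> I]. *)
have core0 (x : T) : I x -> (forall t, N (x * t)) -> x = 0.
  move=> Ix Nx; apply: contrapT => x_neq0; apply: N_neqI.
  apply/seteqP; split=> //.
  (* the largest two-sided ideal contained in [N] *)
  pose K := [set y : T | I y /\ forall t : T, N (y * t)].
  have <- : K = I.
    apply: (@subideal_eq K x) => // [|y []//]; split.
      split=> [|y z]; rewrite !inE.
        split=> [|t]; [exact: ideal0 | rewrite mul0r; exact: N0].
      move=> [Iy Ny] [Iz Nz]; split=> [|t]; first exact: idealB.
      by rewrite mulrBl; apply: NB.
    move=> t y [Iy Ny]; split; split=> [|u].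
    - exact: idealMl.
    - by rewrite -mulrA; apply: NM.
    - exact: idealMr.
    - by rewrite -mulrA.
  by move=> y [_ /(_ 1)]; rewrite mulr1.
(* The annihilator of [I / N]. *)
pose P := [set t : T | forall x, I x -> N (t * x)].
have idP : ideal P.
  split=> [|t p Pp].
    split=> [|p q]; rewrite !inE.
      by move=> x _; rewrite mul0r; exact: N0.
    by move=> Pp Pq x Ix; rewrite mulrBl; apply: NB; [exact: Pp | exact: Pq].
  split=> x Ix; rewrite -mulrA; first by apply: NM; apply: Pp.
  by apply: Pp; apply: idealMl.
(* Otherwise every product of two elements of [I] satisfies [core0], so [I I = 0] and [annI0] kills
   [I]. *)
have I2N : ~ (forall x y, I x -> I y -> N (x * y)).
  move=> I2N; apply: I_neq0; apply/seteqP.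
  split=> [x Ix|_ ->]; last exact: ideal0.
  apply: annI0 => y Iy; apply: core0; first exact: idealMl.
  by move=> t; rewrite -mulrA; apply: I2N => //; apply: idealMr.
(* A nonzero [p x] would lie in [P] and [I], forcing [I] into [P] and so [I I] into [N]. *)
have P0 p : P p -> p = 0.
  move=> Pp; apply: annI0 => x Ix; apply: contrapT => px_neq0; apply: I2N.
  have PI : P `&` I = I.
    apply: (@subideal_eq _ (p * x)) => //; first exact: ideal_setI.
    by split; [exact: (idealMr idP) | exact: idealMl].
  by move=> y z; rewrite -{1}PI => -[Py _] Iz; apply: Py.
have [a [Ia aN]] : exists a, I a /\ ~ N a.
  apply: contrapT => IN; apply: N_neqI; apply/seteqP; split=> // x Ix.
  by apply: contrapT => xN; apply: IN; exists x.
(* Simplicity of [I / N] on elements: [K] is [T b + N], which lies between [N] and [I] and contains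
   [b]. *)
have cycI (b c : T) : I b -> ~ N b -> I c -> exists t : T, N (t * b - c).
  move=> Ib bN Ic; pose K := [set y : T | exists t : T, N (t * b - y)].
  have sK : submodule (K : set T^o).
    apply/submoduleP; split=> [|u y z [t Nty] [v Nvz]].
      by exists 0; rewrite mul0r subr0; exact: N0.
    exists (u * t + v); rewrite mulrDl opprD addrACA -mulrA -mulrBr.
    by apply: ND => //; apply: NM.
  have NK : N `<=` K.
    move=> y Ny; exists 0; rewrite mul0r; apply: NB => //.
  have KI : K `<=` I.
    move=> y [t /NI Ity]; rewrite -[y](subKr (t * b)).
    by apply: idealB => //; apply: idealMl.
  have Kb : K b by exists 1; rewrite mul1r subrr; exact: N0.
  have [KN|KI'] := maxN K sK NK KI; first by case: bN; rewrite -KN.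
  by have : K c by rewrite KI'.
(* The annihilator of the class of [a] in [I / N]; since [I] is only a set, the quotient is taken of
   the regular module instead. *)
pose L : set T^o := [set t : T | N (t * a)].
have sL : submodule L.
  apply/submoduleP; split=> [|t u v]; rewrite /L /=.
    by rewrite mul0r; exact: N0.
  by move=> Nu Nv; rewrite mulrDl -mulrA; apply: ND => //; apply: NM.
(* [T / L] is isomorphic to [I / N], since [I = T a + N]. *)
exists (quot_lmod sL); split.
  apply: simple_of_cyclic.
    exists (quot_proj sL (1 : T)) => /quot_proj_eq0; rewrite /L /= mul1r //.
  move=> m m'.
  have [t <-] := quot_proj_surj m; have [u <-] := quot_proj_surj m'.
  move=> /(contra_not (quot_proj_eq0 sL t).2) taN.
  have [s Ns] := cycI (t * a) (u * a) (idealMl idI t Ia) taN (idealMl idI u Ia).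
  exists s; rewrite quot_projZ; apply/quot_proj_eq.
  by rewrite /L /= mulrBl -mulrA.
apply/seteqP; split=> [t tQ0|_ -> m]; last by rewrite scale0r.
(* Modulo [N], [x] is some [s a], so [t x] is [t s a], which is in [N] because [t] kills the class
   of [s]. *)
apply: P0 => x Ix.
have [s Ns] := cycI a x Ia aN Ix.
have Ntsa : N (t * s * a).
  by apply/(quot_proj_eq0 sL (t * s)); rewrite -(quot_projZ sL t s); apply: tQ0.
have -> : t * x = t * (s * a) - t * (s * a - x) by rewrite -mulrBr subKr.
by apply: NB; [rewrite mulrA | exact: NM].
Qed.

End MaximalSubring.

(** * The equivalence and the vanishing of the conductors *)

Theorem proposition2p5 (T : pzRingType) (R : subring T) (I : set T)
    (maxR : maximal_subring R) (idealI : ideal I) (I_neq0 : I <> [set 0])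
    (RI0 : R `&` I = [set 0]) :
  let cond1 :=
    [/\ left_primitive_ring (subring_type R),
        left_annihilator I = [set 0] &
        exists N : set T^o, maximal_submodule (I : set T^o) N] in
  let cond2 := left_primitive_ring T /\ left_primitive_ideal I in
  (cond1 <-> cond2) /\
  (cond1 \/ cond2 ->
    [/\ conductor R = [set 0], left_conductor R = [set 0] &
        right_conductor R = [set 0]]).
Proof.
move=> cond1 cond2.
have primRI := primitive_subring_primitive_ideal maxR idealI I_neq0 RI0.
have cond12 : cond1 <-> cond2.
  split=> [[/primRI primI annI [N maxN]]|[[M [simM annM]] /primRI primR]].
    split=> //.
    exact: (primitive_of_maximal_submodule maxR idealI I_neq0 RI0 annI maxN).
  split=> //; first exact: primitive_left_annihilator annM idealI I_neq0.
  exact: primitive_maximal_submodule annM idealI I_neq0.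
split=> // cond; have [[M [simM annM]] _] : cond2 by case: cond => // /cond12.
(* For [y] in [I], [y x] lies in both [R] and [I]; hence [I x = 0]. *)
have left0 x : left_conductor R x -> x = 0.
  move=> Rx.
  apply: (primitive_right_annihilator simM annM idealI I_neq0) => y Iy.
  by apply: (subring_ideal_eq0 RI0); [exact: Rx | exact: idealMr].
have right0 x : right_conductor R x -> x = 0.
  move=> xR; have : left_annihilator I x.
    move=> y Iy.
    by apply: (subring_ideal_eq0 RI0); [exact: xR | exact: idealMl].
  by rewrite (primitive_left_annihilator simM annM idealI I_neq0).
have R0 := subring0 R.
split; apply/seteqP; split=> [x Rx|_ ->] //.
(* Right factor [1] puts the two-sided conductor inside the left one. *)
- by apply: left0 => t; have := Rx t 1; rewrite mulr1.
- by move=> s t; rewrite mulr0 mul0r.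
- exact: left0.
- by move=> t; rewrite mulr0.
- exact: right0.
- by move=> t; rewrite mul0r.
Qed.
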